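(* For every constant $\lambda$ with $0<\lambda<1$, the generalized work function algorithm $\mathrm{WFA}_\lambda$ is constant competitive for the CNN problem; that is, there are constants $c\geq 1$ and $c_0$ (depending only on $\lambda$) such that for every origin and every finite request sequence $\rho$, the total distance travelled by $\mathrm{WFA}_\lambda$ (with any choice among minimizers at each step) is at most $c\cdot \mathrm{Opt}_\rho + c_0$.
   Context: The CNN problem: a single server moves in $\mathbb{R}^2$ with the metric $d((x_1,y_1),(x_2,y_2))=|x_1-x_2|+|y_1-y_2|$, starting at a given origin $\mathcal{O}\in\mathbb{R}^2$. Requests arrive online; a request is given by a point $(a,b)\in\mathbb{R}^2$ and corresponds to the set $r(a,b)=\{(x,y)\in\mathbb{R}^2: x=a \text{ or } y=b\}$; it is served by moving the server to some point of $r(a,b)$, without knowledge of future requests. The cost is the total travelled distance; $\mathrm{Opt}_\rho$ is the minimum cost of a path starting at $\mathcal{O}$ that visits, in order, a point of each request of $\rho$. For a request sequence $\sigma=r_1,\dots,r_n$ the work function $W_\sigma(s)$ is the minimum of $d(\mathcal{O},s_1)+\sum_{i=1}^{n-1}d(s_i,s_{i+1})+d(s_n,s)$ over $s_i\in r_i$ (for the empty sequence, $W(s)=d(\mathcal{O},s)$). The algorithm $\mathrm{WFA}_\lambda$: if after serving $\sigma$ the server is at $s$ and a new request $r$ arrives, it moves to any point $s'\in\mathrm{Argmin}_{t\in\mathbb{R}^2}\{W_{\sigma,r}(t)+\lambda d(s,t)\}$. An algorithm is $c$-competitive if there is a constant $c_0$ such that its cost on every instance is at most $c$ times the optimal cost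 plus $c_0$. *)

(* Defs.v *)
From mathcomp Require Import all_boot all_order all_algebra.
From mathcomp Require Import mathcomp_extra boolp classical_sets reals.
From mathcomp Require Import lra.

Set Implicit Arguments.
Unset Strict Implicit.
Unset Printing Implicit Defensive.

Import Order.TTheory GRing.Theory Num.Theory.

Local Open Scope ring_scope.
Local Open Scope classical_set_scope.

Definition dist (R : realType) (p q : R * R) : R :=
  `|p.1 - q.1| + `|p.2 - q.2|.

(* A request is represented by its point [r = (a, b)]. *)
Definition request_set (R : realType) (r : R * R) : set (R * R) :=
  [set p | p.1 = r.1 \/ p.2 = r.2].

Fixpoint travel (R : realType) (p : R * R) (ss : seq (R * R)) : R :=
  if ss is q :: ss' then dist p q + travel q ss' else 0.

Fixpoint serves (R : realType) (rho ss : seq (R * R)) : Prop :=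
  match rho, ss with
  | [::], [::] => True
  | r :: rho', s :: ss' => request_set r s /\ serves rho' ss'
  | _, _ => False
  end.

(* [opt] and [work] are written as infima; both are attained minima, see
   [opt_minimum] and [work_minimum] below. *)
Definition opt (R : realType) (O : R * R) (rho : seq (R * R)) : R :=
  inf [set travel O ss | ss in serves rho].

Definition work (R : realType) (O : R * R) (sigma : seq (R * R))
    (s : R * R) : R :=
  inf [set travel O (rcons ss s) | ss in serves sigma].

Definition argmin (R : realType) (T : Type) (f : T -> R) : set T :=
  [set t | forall u, f t <= f u].

(* An algorithm is identified with the relation "on origin [O] and requests
   [rho], the successive server positions after [O] may be [ss]"; the relation
   accommodates arbitrary tie-breaking. *)
Definition algorithm (R : realType) : Type :=
  R * R -> seq (R * R) -> seq (R * R) -> Prop.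

(* [nth O (O :: ss) i] is the position before the [i]-th request (from 0) and
   [nth O ss i] the position after it. *)
Definition WFA (R : realType) (lambda : R) : algorithm R :=
  fun O rho ss =>
    size ss = size rho /\
    forall i, (i < size rho)%N ->
      argmin (fun t => work O (take i.+1 rho) t
                       + lambda * dist (nth O (O :: ss) i) t)
             (nth O ss i).

Definition competitive (R : realType) (c : R) (A : algorithm R) : Prop :=
  exists c0 : R, forall (O : R * R) (rho ss : seq (R * R)),
    A O rho ss -> travel O ss <= c * opt O rho + c0.

(* Only the finitely many "lazy" service paths, which move in one coordinate
   per request, matter for the minima. *)
Fixpoint lazy_paths (R : realType) (p : R * R) (rho : seq (R * R)) :
    seq (seq (R * R)) :=
  if rho is r :: rho' then
    [seq (r.1, p.2) :: l | l <- lazy_paths (r.1, p.2) rho'] ++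
    [seq (p.1, r.2) :: l | l <- lazy_paths (p.1, r.2) rho']
  else [:: [::]].

Lemma dist_ge0 (R : realType) (p q : R * R) : 0 <= dist p q.
Proof. by rewrite addr_ge0. Qed.

Lemma dist_triangle (R : realType) (p q s : R * R) :
  dist p s <= dist p q + dist q s.
Proof.
rewrite /dist.
have := ler_distD q.1 p.1 s.1; have := ler_distD q.2 p.2 s.2; lra.
Qed.

Lemma travel_ge0 (R : realType) (p : R * R) ss : 0 <= travel p ss.
Proof. by elim: ss p => //= q ss IH p; rewrite addr_ge0 ?dist_ge0. Qed.

Lemma travel_rcons (R : realType) (p : R * R) ss s :
  travel p (rcons ss s) = travel p ss + dist (last p ss) s.
Proof.
by elim: ss p => [|q ss IH] p /=; rewrite ?addr0 ?add0r // IH addrA.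
Qed.

Lemma lazy_serves (R : realType) (p : R * R) rho l :
  l \in lazy_paths p rho -> serves rho l.
Proof.
elim: rho p l => [|r rho IH] p l /=; first by rewrite inE => /eqP->.
rewrite mem_cat => /orP[] /mapP[l' /IH sl' ->]; split => //.
- by left.
- by right.
Qed.

Lemma lazy_paths_neq0 (R : realType) (p : R * R) rho :
  exists l, l \in lazy_paths p rho.
Proof.
elim: rho p => [|r rho IH] p; first by exists [::]; rewrite inE.
have [l hl] := IH (r.1, p.2); exists ((r.1, p.2) :: l).
by rewrite mem_cat map_f.
Qed.

Lemma lazy_le (R : realType) (p q : R * R) rho ss : serves rho ss ->
  exists2 l, l \in lazy_paths p rho &
    forall t, travel p (l ++ t) <= dist p q + travel q (ss ++ t).
Proof.
elim: rho ss p q => [|r rho IH] [|s ss] p q //=.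
  move=> _; exists [::]; first by rewrite inE.
  case=> [|u t] /=; first by rewrite addr0 dist_ge0.
  by rewrite addrA lerD2r dist_triangle.
move=> [rs /IH hss].
have htri := dist_triangle p q s.
case: rs => e.
- have [l hl le_l] := hss (r.1, p.2) s; exists ((r.1, p.2) :: l).
    by rewrite mem_cat map_f.
  move=> t /=; have := le_l t; move: htri.
  by rewrite /dist /= e !subrr normr0; lra.
- have [l hl le_l] := hss (p.1, r.2) s; exists ((p.1, r.2) :: l).
    by rewrite mem_cat [X in _ || X]map_f ?orbT.
  move=> t /=; have := le_l t; move: htri.
  by rewrite /dist /= e !subrr normr0; lra.
Qed.

Lemma seq_minimum (R : realType) (T : eqType) (F : T -> R) (L : seq T) x :
  x \in L -> exists2 m, m \in L & forall y, y \in L -> F m <= F y.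
Proof.
elim: L x => // a L IH x _.
case: L IH => [|b L] IH.
  by exists a; rewrite ?mem_head // => y; rewrite inE => /eqP->.
have [m hm le_m] := IH b (mem_head _ _).
have [le_am|lt_ma] := leP (F a) (F m).
- exists a; rewrite ?mem_head // => y; rewrite inE => /orP[/eqP->//|hy].
  exact: le_trans le_am (le_m _ hy).
- exists m; first by rewrite inE hm orbT.
  by move=> y; rewrite inE => /orP[/eqP->|/le_m//]; exact: ltW.
Qed.

Lemma inf_minimum (R : realType) (A : set R) m : A m -> lbound A m -> inf A = m.
Proof.
move=> Am lbm; apply/eqP; rewrite eq_le; apply/andP; split.
- by apply: ge_inf => //; exists m.
- by apply: lb_le_inf => //; exists m.
Qed.

Lemma travel_minimum (R : realType) (O : R * R) rho t :
  let A := [set travel O (ss ++ t) | ss in serves rho] in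
  A (inf A) /\ lbound A (inf A).
Proof.
move=> A; have [l0 hl0] := lazy_paths_neq0 O rho.
have [m hm le_m] := seq_minimum (fun l => travel O (l ++ t)) hl0.
have Am : A (travel O (m ++ t)) by exists m => //; exact: lazy_serves hm.
have lbm : lbound A (travel O (m ++ t)).
  move=> _ [ss /(@lazy_le _ O O)[l hl le_l] <-].
  apply: le_trans (le_m _ hl) _; have := le_l t.
  by rewrite /dist !subrr normr0 !add0r.
by rewrite (inf_minimum Am lbm).
Qed.

Lemma opt_minimum (R : realType) (O : R * R) rho :
  (exists2 ss, serves rho ss & travel O ss = opt O rho) /\
  (forall ss, serves rho ss -> opt O rho <= travel O ss).
Proof.
have := travel_minimum O rho [::]; rewrite /opt.
under eq_imagel do rewrite cats0.
by move=> [h1 h2]; split => // ss hss; apply: h2; exists ss.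
Qed.

Lemma work_minimum (R : realType) (O : R * R) sigma s :
  (exists2 ss, serves sigma ss & travel O (rcons ss s) = work O sigma s) /\
  (forall ss, serves sigma ss -> work O sigma s <= travel O (rcons ss s)).
Proof.
have := travel_minimum O sigma [:: s]; rewrite /work.
under eq_imagel do rewrite cats1.
by move=> [h1 h2]; split => // ss hss; apply: h2; exists ss.
Qed.

Lemma argmin_work_neq0 (R : realType) (lambda : R) (O s : R * R) sigma :
  0 <= lambda <= 1 ->
  exists t, argmin (fun t => work O sigma t + lambda * dist s t) t.
Proof.
move=> /andP[l0 l1]; have [k hk] := lazy_paths_neq0 O sigma.
have [m hm le_m] :=
  seq_minimum (fun l => travel O l + lambda * dist s (last O l)) hk.
exists (last O m) => u.
have [_ /(_ m (lazy_serves hm))] := work_minimum O sigma (last O m).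
rewrite travel_rcons /(dist (last O m) _) !subrr normr0 !addr0 => le1.
have [[ss hss <-] _] := work_minimum O sigma u.
have [l hl /(_ [:: u])] := lazy_le O O hss.
rewrite !cats1 /(dist O O) !subrr normr0 !add0r !travel_rcons => le2.
have le3 := le_m _ hl.
have := ler_wpM2l l0 (dist_triangle s u (last O l)).
rewrite [dist u _](_ : _ = dist (last O l) u); last first.
  by rewrite /dist distrC [X in _ + X]distrC.
have := ler_piMl (dist_ge0 (last O l) u) l1.
rewrite [lambda * (_ + dist _ u)]mulrDr /=.
lra.
Qed.

(* Main.v *)
(* After a request [q] every point off the cross of [q] is dominated: the work
   function there exceeds its value at a point of the cross by the full distance
   to that point. Conversely a position [s] of the algorithm is supported: the
   work function [W] descends from [s] nowhere faster than at slope
   [lambda < 1]. If the next request is at distance [m] from [s], then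
   [W s] rises by at most [2 m], and
   [lambda * d(s, s') + W' s' <= W' s], so the cost of the algorithm is
   bounded by the sum of the [m]'s, up to a factor. It remains to exhibit a
   potential of [W] that rises by a constant times [m] at each request and stays
   between 0 and [2 min W].

   The potential is a minimum over three points [t1], [t2], [t3] and two numbers
   [x], [y]. Its main part [W t1 + W t2 - (1 - th) d(t1, t2)] rises unless
   [t1], [t2] lie on both the old and the new cross; the slack of [t3] below the
   cones over [t1] and [t2] handles two crosses meeting in two points only. When
   the crosses share a line, say vertical, the points of the old horizontal line
   are lifted by the height difference until they reach the cone over the
   vertical line, and this is what the terms in [x] and [y] measure. *)

Require Import Defs.
From mathcomp Require Import all_boot all_order all_algebra.
From mathcomp Require Import boolp classical_sets reals.
From mathcomp Require Import ring lra.

Set Implicit Arguments.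
Unset Strict Implicit.
Unset Printing Implicit Defensive.

Import Order.TTheory GRing.Theory Num.Theory.
Local Open Scope ring_scope.

Lemma distC (R : realType) (p t : R * R) : dist p t = dist t p.
Proof. by rewrite /dist distrC [X in _ + X]distrC. Qed.

Lemma distxx (R : realType) (p : R * R) : dist p p = 0.
Proof. by rewrite /dist !subrr normr0 addr0. Qed.

(** * Lipschitz regularization of a function on the line *)

Section Regularization.
Variables (R : realType) (lambda : R).
Hypothesis lambda_ge0 : 0 <= lambda.

(* The largest [lambda]-Lipschitz minorant of [u]. *)
Definition regularize (u : R -> R) (b : R) : R :=
  inf [set u y + lambda * `|y - b| | y in setT]%classic.

Lemma regularize_le (u : R -> R) b y : (forall z, 0 <= u z) ->
  regularize u b <= u y + lambda * `|y - b|.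
Proof.
move=> u0; apply: ge_inf; last by exists y.
by exists 0 => _ [z _ <-]; rewrite addr_ge0 // mulr_ge0.
Qed.

Lemma le_regularize (u : R -> R) b c :
  (forall y, c <= u y + lambda * `|y - b|) -> c <= regularize u b.
Proof.
move=> h; apply: lb_le_inf; first by exists (u 0 + lambda * `|0 - b|); exists 0.
by move=> _ [y _ <-]; exact: h.
Qed.

Lemma regularize_lip (u v : R -> R) a b c : (forall z, 0 <= v z) ->
  (forall y, v y <= u y + a) ->
  regularize v c <= regularize u b + a + lambda * `|b - c|.
Proof.
move=> v0 vu; rewrite -lerBlDr -lerBlDr; apply: le_regularize => y.
have h1 := regularize_le c y v0.
have h2 := ler_wpM2l lambda_ge0 (ler_distD b y c).
have h3 := vu y; lra.
Qed.

End Regularization.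

(** * The potential and its constants *)

Section Potential.
Variables (R : realType) (th : R).
Hypotheses (th_gt0 : 0 < th) (th_lt : th < 2^-1).
Local Notation lambda := (1 - 2 * th).
Implicit Types (W : R * R -> R) (p q r s t : R * R).

Definition lipschitz W := forall p t, W p <= W t + dist p t.

Definition dominated W q := forall p,
  W (q.1, p.2) + `|p.1 - q.1| <= W p \/ W (p.1, q.2) + `|p.2 - q.2| <= W p.

Definition supported W s := forall t, W s <= W t + lambda * dist s t.

Definition near q D t := `|t.1 - q.1| <= D \/ `|t.2 - q.2| <= D.

Definition swap p : R * R := (p.2, p.1).

(** How far [p] lies below the cone of slope [1 - th] over [t]. This slope is midway between
    [lambda] and 1, so that supported positions and dominated points both leave a margin [th]. *)
Definition slack W p t := W t + (1 - th) * dist p t - W p.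

(* How far [(x, q.2)] lies below the cone of slope [1 - th] over the vertical line
   of [q]. The regularization along that line makes [vslack] decrease when [q.2]
   changes even where [W] has slope 1 along the line. *)
Definition vslack W q x :=
  regularize lambda (fun y => W (q.1, y)) q.2 + (1 - th) * `|x - q.1|
  - W (x, q.2).

(** Chosen so that the penalty of a single point can pay for [8 * dist t1 t2] in the mixed case of
    [vterm_move]. *)
Definition spread_weight : R := 10 + 8 / th.
Local Notation B := spread_weight.
(** Per unit of [D] in [vterm_move]: 2 from [vslack_move] and [B] from each of the two penalties. *)
Definition distortion : R := 2 + 2 * B.
Local Notation K := distortion.
Definition slack_weight : R := th / 4.
Local Notation de := slack_weight.
(** With this weight two errors [et * (K * D)] use up half of the gain [de * th * D] of
    [potential_projection]. *)
Definition line_weight : R := de * th / (4 * K).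
Local Notation et := line_weight.

(* The penalty switches the term off unless [t1] and [t2] are close to the
   vertical line of [q], compared with [vslack]. *)
Definition vterm W q t1 t2 x :=
  Num.max 0 (vslack W q x - B * (`|t1.1 - q.1| + `|t2.1 - q.1|)).

Definition potential W q t1 t2 t3 x y :=
  W t1 + W t2 - (1 - th) * dist t1 t2
  - de * Num.min (slack W t3 t1) (slack W t3 t2)
  - et * (vterm W q t1 t2 x
          + vterm (W \o swap) (swap q) (swap t1) (swap t2) y).

Lemma lambda_ge0 : 0 <= lambda. Proof. by move: th_lt; lra. Qed.
Local Hint Resolve lambda_ge0 : core.

Lemma B_th : B * th = 10 * th + 8.
Proof. by rewrite /B; field; apply/negP => /eqP h; move: th_gt0; lra. Qed.

Lemma B_gt : 26 < B.
Proof. by rewrite -(ltr_pM2r th_gt0) B_th; move: th_lt; lra. Qed.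

Lemma K_gt0 : 0 < K. Proof. by have := B_gt; rewrite /K; lra. Qed.

Lemma et_K : et * K = th * th / 16.
Proof.
by rewrite /et /de; field; apply/negP => /eqP h; have := K_gt0; lra.
Qed.

Lemma et_gt0 : 0 < et.
Proof.
rewrite -(ltr_pM2r K_gt0) et_K mul0r divr_gt0 //; exact: mulr_gt0.
Qed.

Lemma et_lt : et < th / 16.
Proof.
rewrite -(ltr_pM2r K_gt0) et_K -mulrA -mulrA (ltr_pM2l th_gt0).
have := B_gt; move: th_lt; rewrite /K; lra.
Qed.

Lemma de_ge0 : 0 <= de. Proof. by rewrite /de; move: th_gt0; lra. Qed.

(** * Exchange of the coordinates *)

Lemma dist_swap p t : dist (swap p) (swap t) = dist p t.
Proof. by rewrite /dist addrC. Qed.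

Lemma swapK : involutive swap. Proof. by case. Qed.

Lemma potential_swap W q t1 t2 t3 x y :
  potential (W \o swap) (swap q) (swap t1) (swap t2) (swap t3) y x
  = potential W q t1 t2 t3 x y.
Proof.
rewrite /potential /slack /= !swapK !dist_swap.
by rewrite [X in _ - et * X = _]addrC; congr (_ - et * (_ + _)).
Qed.

Lemma lipschitz_swap W : lipschitz W -> lipschitz (W \o swap).
Proof. by move=> h p t /=; rewrite -dist_swap; exact: h. Qed.

Lemma dominated_swap W q : dominated W q -> dominated (W \o swap) (swap q).
Proof. by move=> h p; have := h (swap p); rewrite /swap /=; tauto. Qed.

Lemma supported_swap W s : supported W s -> supported (W \o swap) (swap s).
Proof.
by move=> h t /=; rewrite swapK -dist_swap swapK; exact: h.
Qed.

Lemma near_swap q D t : near q D t -> near (swap q) D (swap t).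
Proof. by rewrite /near /=; tauto. Qed.

Lemma request_set_swap q t : request_set q t -> request_set (swap q) (swap t).
Proof. by rewrite /request_set /=; tauto. Qed.

(** * Bounds on the slacks *)

(* Either [(x, r.2)] is dominated through the line [q.1], or it is dominated by
   [(x, q.2)] and has lost slack in proportion to [`|r.2 - q.2|]. *)
Lemma vslack_move W q r x : lipschitz W -> (forall p, 0 <= W p) ->
  dominated W q ->
  vslack W r x <= 2 * `|r.1 - q.1| \/
  vslack W r x <=
    vslack W q x + 2 * `|r.1 - q.1| - 2 * th * `|r.2 - q.2|.
Proof.
move=> lip W0 dom; rewrite /vslack.
have [/=|/=] := dom (x, r.2) => h; [left | right].
- have h1 := @regularize_le _ lambda lambda_ge0 (fun y => W (r.1, y)) r.2 r.2
    (fun y => W0 _).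
  have h2 := lip (r.1, r.2) (q.1, r.2).
  have h3 := ler_distD q.1 x r.1.
  have h4 := mulr_ge0 (ltW th_gt0) (normr_ge0 (x - r.1)).
  move: h1 h2 h3; rewrite /dist /= subrr normr0 (distrC q.1 r.1); lra.
(* The regularization follows the change of height at slope [lambda], while domination gains slope
   1; the difference is [2 * th]. *)
- have h1 : regularize lambda (fun y => W (r.1, y)) r.2 <=
     regularize lambda (fun y => W (q.1, y)) q.2 + `|r.1 - q.1|
       + lambda * `|q.2 - r.2|.
    apply: regularize_lip => // y.
    by have := lip (r.1, y) (q.1, y); rewrite /dist /= subrr normr0 addr0.
  have h3 := ler_distD q.1 x r.1.
  have h4 := ler_wpM2l (ltW th_gt0) (ler_distD r.1 x q.1).
  have h5 : 0 <= 1 - th by move: th_lt; lra.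
  have h6 := ler_wpM2l h5 h3.
  have h7 := mulr_ge0 (ltW th_gt0) (normr_ge0 (r.1 - q.1)).
  move: h1 h6; rewrite (distrC q.1 r.1) (distrC q.2 r.2); lra.
Qed.

(** The regularization is tested at height [t.2]. The horizontal distance from [t] to the line is
    then paid twice, in [W] and in the cone. *)
Lemma vslack_le_slack W r t x : lipschitz W -> (forall p, 0 <= W p) ->
  vslack W r x <= slack W (x, r.2) t + 2 * `|t.1 - r.1|.
Proof.
move=> lip W0; rewrite /vslack /slack /dist /=.
have h1 := @regularize_le _ lambda lambda_ge0 (fun y => W (r.1, y)) r.2 t.2
    (fun y => W0 _).
have h2 := lip (r.1, t.2) t.
have h3 := ler_distD t.1 x r.1.
have h5 : 0 <= 1 - th by move: th_lt; lra.
have h6 := ler_wpM2l h5 h3.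
have h7 := mulr_ge0 (ltW th_gt0) (normr_ge0 (t.1 - r.1)).
have h8 := mulr_ge0 (ltW th_gt0) (normr_ge0 (t.2 - r.2)).
move: h1 h2 h6; rewrite /dist /= subrr normr0 addr0 (distrC r.1 t.1).
rewrite (distrC r.2 t.2); lra.
Qed.

Lemma supported_slack W s t : supported W s -> th * dist s t <= slack W s t.
Proof. by move=> /(_ t); rewrite /slack; lra. Qed.

Lemma lipschitz_slack W p t : lipschitz W -> slack W p t <= 2 * dist p t.
Proof.
move=> /(_ t p); rewrite /slack (distC t p).
by have := mulr_ge0 (ltW th_gt0) (dist_ge0 p t); lra.
Qed.

(** Regularizing at slope [lambda] costs nothing here: support bounds [W] on the whole vertical line
    by a cone of that slope around [s]. *)
Lemma supported_vslack W q s : supported W s -> s.2 = q.2 ->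
  th * `|s.1 - q.1| <= vslack W q s.1.
Proof.
move=> sup e; rewrite /vslack -e -surjective_pairing.
suff : W s - lambda * `|s.1 - q.1| <=
    regularize lambda (fun y => W (q.1, y)) s.2 by lra.
apply: le_regularize => y; have := sup (q.1, y).
by rewrite /dist /= (distrC y); lra.
Qed.

(** Off the cross, descent at slope 1 would contradict support at slope [lambda < 1]. *)
Lemma supported_request_set W q s : dominated W q -> supported W s ->
  request_set q s.
Proof.
have pos z : z <= lambda * z -> 0 <= z -> z = 0.
  move=> h1 h2; apply/eqP; rewrite eq_le h2 andbT -(pmulr_rle0 _ th_gt0); lra.
move=> /(_ s) dom sup; case: dom => h; [left|right].
- have := sup (q.1, s.2); rewrite /dist /= subrr normr0 addr0 => h1.
  by apply/eqP; rewrite -subr_eq0 -normr_eq0 (pos _ _ (normr_ge0 _)) //; lra.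
- have := sup (s.1, q.2); rewrite /dist /= subrr normr0 add0r => h1.
  by apply/eqP; rewrite -subr_eq0 -normr_eq0 (pos _ _ (normr_ge0 _)) //; lra.
Qed.

(** * The penalized terms under a change of request *)

Lemma vtermC W q t1 t2 x : vterm W q t1 t2 x = vterm W q t2 t1 x.
Proof. by rewrite /vterm [`|t1.1 - _| + _]addrC. Qed.

Lemma vterm_ge0 W q t1 t2 x : 0 <= vterm W q t1 t2 x.
Proof. by rewrite le_max lexx. Qed.

Lemma vterm_ge W q t1 t2 x :
  vslack W q x - B * (`|t1.1 - q.1| + `|t2.1 - q.1|) <= vterm W q t1 t2 x.
Proof. by rewrite le_max lexx orbT. Qed.

Lemma near_ge0 q D t : near q D t -> 0 <= D.
Proof. by case; apply: le_trans. Qed.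

(** The last hypothesis is what remains when no slack is large compared with [dist t1 t2]. If the
    vertical lines are within [D], [vslack] and the penalties change by multiples of [D]; otherwise
    that hypothesis or the loss in [vslack_move] is set against the penalties. *)
Lemma vterm_move W q r t1 t2 x D :
  lipschitz W -> (forall p, 0 <= W p) -> dominated W q ->
  request_set r t1 -> request_set r t2 -> near q D t1 -> near q D t2 ->
  vslack W r x <= 8 * dist t1 t2 + 2 * (`|t1.1 - r.1| + `|t2.1 - r.1|) ->
  vterm W r t1 t2 x <= vterm W q t1 t2 x + K * D.
Proof.
move=> lip W0 dom rt1 rt2 nt1 nt2 ub.
have D0 := near_ge0 nt1.
have B0 : 0 <= B by have := B_gt; lra.
have BD : 26 * D <= B * D by apply: ler_wpM2r => //; have := B_gt; lra.
have BV t : 26 * `|t.1 - r.1| <= B * `|t.1 - r.1|.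
  by apply: ler_wpM2r => //; have := B_gt; lra.
have KD : K * D = 2 * D + 2 * (B * D) by rewrite /K; ring.
have mv := vslack_move r x lip W0 dom.
have [aD|aD] := leP `|r.1 - q.1| D.
  have v0 := vterm_ge0 W q t1 t2 x; have v1 := vterm_ge W q t1 t2 x.
  rewrite ge_max; apply/andP; split; first by lra.
  have b1 := BV t1; have b2 := BV t2.
  have n1 := normr_ge0 (t1.1 - r.1); have n2 := normr_ge0 (t2.1 - r.1).
  case: mv => mv; first by lra.
  have h1 := ler_wpM2l B0 (ler_distD r.1 t1.1 q.1).
  have h2 := ler_wpM2l B0 (ler_distD r.1 t2.1 q.1).
  have h3 := ler_wpM2l B0 aD.
  have h4 := mulr_ge0 (ltW th_gt0) (normr_ge0 (r.2 - q.2)).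
  lra.
(* As the vertical lines are more than [D] apart, [u1] must be close to the horizontal line of
   [q]. *)
have mixed u1 u2 : u1.1 = r.1 -> u2.2 = r.2 -> near q D u1 -> near q D u2 ->
  vslack W r x <= 8 * dist u1 u2 + 2 * (`|u1.1 - r.1| + `|u2.1 - r.1|) ->
  vterm W r u1 u2 x <= vterm W q u1 u2 x + K * D.
  move=> e1 e2; rewrite /near e1 e2 /dist e1 e2 subrr normr0 add0r => nu1 nu2 ub'.
  have v0 := vterm_ge0 W q u1 u2 x; have v1 := vterm_ge W q u1 u2 x.
  have b2 := BV u2; have n2 := normr_ge0 (u2.1 - r.1).
  rewrite ge_max; apply/andP; split; first by lra.
  case: nu1 => nu1; first by lra.
  have h1 := ler_distD q.2 u1.2 r.2.
  rewrite (distrC q.2 r.2) in h1; rewrite (distrC r.1 u2.1) in ub'.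
  have bn := normr_ge0 (r.2 - q.2).
  rewrite e1 subrr normr0 add0r.
  case: nu2 => nu2; last by lra.
  have h2 := ler_distD u2.1 r.1 q.1; rewrite (distrC r.1 u2.1) in h2.
  case: mv => mv; first by lra.
  have h3 := ler_wpM2l B0 h2; have h4 := ler_wpM2l B0 nu2.
  rewrite e1 in v1.
  (* Either the loss of [vslack] in height absorbs the shift of the vertical line, or [u2] is so far
     from that line that its penalty cancels the upper bound up to [8 * D]. *)
  have [sm|lg] := leP `|u2.1 - r.1| (th * `|r.2 - q.2|); first by lra.
  have h5 : B * `|u2.1 - r.1| = 10 * `|u2.1 - r.1| + 8 * (th^-1 * `|u2.1 - r.1|).
    by rewrite /B; ring.
  have h6 : `|r.2 - q.2| <= th^-1 * `|u2.1 - r.1|.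
    by rewrite mulrC ler_pdivlMr // mulrC ltW.
  lra.
case: rt1 => e1; case: rt2 => e2.
- have v0 := vterm_ge0 W q t1 t2 x.
  move: nt1 nt2 ub; rewrite /near /dist e1 e2 !subrr normr0 => nt1 nt2 ub.
  rewrite ge_max; apply/andP; split; first by lra.
  rewrite e1 e2 !subrr normr0.
  have h := ler_distD q.2 t1.2 t2.2; rewrite (distrC q.2) in h.
  case: nt1; first by lra.
  case: nt2; first by lra.
  lra.
- exact: mixed.
- rewrite vtermC [vterm W q _ _ _]vtermC; apply: mixed => //.
  by rewrite distC [`|t2.1 - _| + _]addrC.
- have v0 := vterm_ge0 W q t1 t2 x.
  have b1 := BV t1; have b2 := BV t2.
  have n1 := normr_ge0 (t1.1 - r.1); have n2 := normr_ge0 (t2.1 - r.1).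
  have h := ler_distD r.1 t1.1 t2.1; rewrite (distrC r.1) in h.
  move: ub; rewrite /dist e1 e2 subrr normr0 => ub.
  rewrite ge_max; apply/andP; split; first by lra.
  lra.
Qed.

Lemma vterm_le W q t1 t2 t1' t2' x :
  `|t1'.1 - q.1| <= `|t1.1 - q.1| -> `|t2'.1 - q.1| <= `|t2.1 - q.1| ->
  vterm W q t1 t2 x <= vterm W q t1' t2' x.
Proof.
move=> h1 h2; have B0 : 0 <= B by have := B_gt; lra.
have := vterm_ge W q t1' t2' x; have := vterm_ge0 W q t1' t2' x => v0 v1.
rewrite ge_max v0 /=; apply: le_trans v1.
by rewrite lerD2l lerN2; apply: ler_wpM2l => //; exact: lerD.
Qed.

(** * Projection onto a cross *)

Lemma dominated_projection W q t : dominated W q -> exists t',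
  [/\ request_set q t', W t' + dist t t' <= W t, near q (dist t t') t,
      `|t'.1 - q.1| <= `|t.1 - q.1| & `|t'.2 - q.2| <= `|t.2 - q.2|].
Proof.
move=> /(_ t)[h|h].
- exists (q.1, t.2); rewrite /near /dist /= !subrr normr0 addr0.
  by split => //; left.
- exists (t.1, q.2); rewrite /near /dist /= !subrr normr0 add0r.
  by split => //; right.
Qed.

(** At [t1] and [t2], [W] falls at slope 1 and the distance term pays back only [1 - th]; [de] is
    small enough for the slack term to take only part of this margin. Moving [t3] gains through the
    slack term itself. *)
Lemma potential_projection W q t1 t2 t3 t1' t2' t3' x y :
  W t1' + dist t1 t1' <= W t1 -> W t2' + dist t2 t2' <= W t2 ->
  W t3' + dist t3 t3' <= W t3 ->
  `|t1'.1 - q.1| <= `|t1.1 - q.1| -> `|t2'.1 - q.1| <= `|t2.1 - q.1| ->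
  `|t1'.2 - q.2| <= `|t1.2 - q.2| -> `|t2'.2 - q.2| <= `|t2.2 - q.2| ->
  potential W q t1' t2' t3' x y
    + de * th * (dist t1 t1' + dist t2 t2' + dist t3 t3')
  <= potential W q t1 t2 t3 x y.
Proof.
move=> w1 w2 w3 a1 a2 b1 b2; rewrite /potential.
have hv := ler_wpM2l (ltW et_gt0) (vterm_le W x a1 a2).
have hh := ler_wpM2l (ltW et_gt0) (@vterm_le (W \o swap) (swap q)
  (swap t1) (swap t2) (swap t1') (swap t2') y b1 b2).
have ka0 : 0 <= 1 - th by move: th_lt; lra.
have d1 := dist_ge0 t1 t1'; have d2 := dist_ge0 t2 t2'.
have d3 := dist_ge0 t3 t3'.
have e12 : (1 - th) * dist t1 t2 <=
    (1 - th) * (dist t1 t1' + dist t1' t2' + dist t2 t2').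
  apply: ler_wpM2l => //; have := dist_triangle t1 t1' t2.
  by have := dist_triangle t1' t2' t2; rewrite (distC t2' t2); lra.
have sl u u' : W u' + dist u u' <= W u -> slack W t3 u
    <= slack W t3' u' + (W u - W u') + (1 - th) * dist u u' - th * dist t3 t3'.
  move=> wu; rewrite /slack.
  have : (1 - th) * dist t3 u <=
      (1 - th) * (dist t3 t3' + dist t3' u' + dist u u').
    apply: ler_wpM2l => //; have := dist_triangle t3 t3' u.
    by have := dist_triangle t3' u' u; rewrite (distC u' u); lra.
  by lra.
have s1 := sl _ _ w1; have s2 := sl _ _ w2.
have mn : Num.min (slack W t3 t1) (slack W t3 t2) <=
   Num.min (slack W t3' t1') (slack W t3' t2') + (W t1 - W t1') + (W t2 - W t2')
   + (1 - th) * (dist t1 t1' + dist t2 t2') - th * dist t3 t3'.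
  have k1 := mulr_ge0 ka0 d1; have k2 := mulr_ge0 ka0 d2.
  have [le12|lt21] := leP (slack W t3' t1') (slack W t3' t2').
  - by rewrite ge_min; apply/orP; left; lra.
  - by rewrite ge_min; apply/orP; right; lra.
have de0 := de_ge0.
have h := ler_wpM2l de0 mn.
have de1 : 0 <= 1 - de by rewrite /de; move: th_lt; lra.
have h1 := ler_wpM2l de1 w1.
have h2 := ler_wpM2l de1 w2.
have g1 : 2 * de * dist t1 t1' <= th * dist t1 t1'.
  by apply: ler_wpM2r => //; rewrite /de; move: th_gt0; lra.
have g2 : 2 * de * dist t2 t2' <= th * dist t2 t2'.
  by apply: ler_wpM2r => //; rewrite /de; move: th_gt0; lra.
lra.
Qed.

(** * Points of large slack *)

Lemma slack_swap W p t : slack (W \o swap) (swap p) (swap t) = slack W p t.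
Proof. by rewrite /slack /= !swapK dist_swap. Qed.

(** With [t2 = t3 = p] the minimum of the slacks vanishes, and the main part equals
    [2 * W t - slack W p t]. *)
Lemma potential_pair W q t p x y : 0 <= slack W p t ->
  potential W q t p p x y <= 2 * W t - slack W p t.
Proof.
move=> h; rewrite /potential.
have -> : Num.min (slack W p t) (slack W p p) = 0.
  by rewrite {2}/slack distxx mulr0 addr0 subrr; apply/min_idPr.
have v := mulr_ge0 (ltW et_gt0) (vterm_ge0 W q t p x).
have v' := mulr_ge0 (ltW et_gt0)
  (vterm_ge0 (W \o swap) (swap q) (swap t) (swap p) y).
by move: h v v'; rewrite /slack (distC p t); lra.
Qed.

Lemma vterm_le_slack W r t1 t2 x : lipschitz W -> (forall p, 0 <= W p) ->
  vterm W r t1 t2 x <= Num.max 0 (slack W (x, r.2) t1).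
Proof.
move=> lip W0; rewrite ge_max !le_max lexx /=; apply/orP; right.
have h := vslack_le_slack r t1 x lip W0.
have h1 : 2 * `|t1.1 - r.1| <= B * `|t1.1 - r.1|.
  by apply: ler_wpM2r => //; have := B_gt; lra.
have h2 : 0 <= B * `|t2.1 - r.1| by apply: mulr_ge0 => //; have := B_gt; lra.
lra.
Qed.

Lemma potential_ge W r t1 t2 t3 x y Z :
  lipschitz W -> (forall p, 0 <= W p) -> 0 <= Z ->
  slack W t3 t1 <= Z -> slack W (x, r.2) t1 <= Z -> slack W (r.1, y) t1 <= Z ->
  W t1 + W t2 - (1 - th) * dist t1 t2 - (de + 2 * et) * Z
  <= potential W r t1 t2 t3 x y.
Proof.
move=> lip W0 Z0 z3 zx zy; rewrite /potential.
have vx : vterm W r t1 t2 x <= Z.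
  by apply: le_trans (vterm_le_slack _ _ _ _ lip W0) _; rewrite ge_max Z0.
have vy : vterm (W \o swap) (swap r) (swap t1) (swap t2) y <= Z.
  apply: le_trans (vterm_le_slack _ _ _ _ (lipschitz_swap lip) _) _ => //.
    by move=> p; exact: W0.
  by rewrite ge_max Z0 /= (slack_swap W (r.1, y) t1).
have mn : Num.min (slack W t3 t1) (slack W t3 t2) <= Z by rewrite ge_min z3.
have h1 := ler_wpM2l (ltW et_gt0) vx.
have h2 := ler_wpM2l (ltW et_gt0) vy.
have h3 := ler_wpM2l de_ge0 mn.
lra.
Qed.

(** With [Z = slack W p t1], the left potential is at most [2 * W t1 - Z]. The right one loses at
    most [Z / 4] from its main part, and [W t2] is at least [W t1 - dist t1 t2]; the factor 8 leaves
    [Z / 4] to spare. *)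
Lemma potential_pair_improves W q r t1 t2 t3 p x y :
  lipschitz W -> (forall p, 0 <= W p) -> 0 <= slack W p t1 ->
  slack W t3 t1 <= slack W p t1 -> slack W (x, r.2) t1 <= slack W p t1 ->
  slack W (r.1, y) t1 <= slack W p t1 -> 8 * dist t1 t2 <= slack W p t1 ->
  potential W q t1 p p x y + slack W p t1 / 4 <= potential W r t1 t2 t3 x y.
Proof.
move=> lip W0 Z0 z3 zx zy zL.
have h1 := potential_ge t2 lip W0 Z0 z3 zx zy.
have h2 := potential_pair q x y Z0.
have h3 : (de + 2 * et) * slack W p t1 <= 1 / 4 * slack W p t1.
  apply: ler_wpM2r => //; have := et_lt; rewrite /de.
  by move: th_lt; lra.
have h4 := mulr_ge0 (ltW th_gt0) (dist_ge0 t1 t2).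
have h5 := lip t1 t2.
lra.
Qed.

(** * Points close to both crosses *)

Lemma crossing_near q r t D : request_set r t -> near q D t ->
  D < `|r.1 - q.1| -> D < `|r.2 - q.2| ->
  (t.1 = r.1 /\ `|t.2 - q.2| <= D) \/ (t.2 = r.2 /\ `|t.1 - q.1| <= D).
Proof.
move=> [e|e] [h|h] h1 h2; [| left | right |] => //.
- by move: h; rewrite e => /(lt_le_trans h1); rewrite ltxx.
- by move: h; rewrite e => /(lt_le_trans h2); rewrite ltxx.
Qed.

(* If the vertical lines of [q] and [r] are far apart, then [t1], [t2], [t3]
   gather around the two intersections of the crosses, so [t3] is next to [t1] or
   [t2] and replacing it by [s] pays; otherwise the term in [x] does. *)
Lemma near_potential_improves W q r s t1 t2 t3 x y m D :
  lipschitz W -> (forall p, 0 <= W p) -> dominated W q ->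
  supported W s -> s.2 = q.2 ->
  request_set r t1 -> request_set r t2 -> request_set r t3 ->
  near q D t1 -> near q D t2 -> near q D t3 ->
  m <= `|s.1 - r.1| -> m <= `|s.2 - r.2| ->
  8 * (K * D) < th * m -> th * m < 8 * dist t1 t2 ->
  vslack W r x <= 8 * dist t1 t2 + 2 * (`|t1.1 - r.1| + `|t2.1 - r.1|) ->
  vslack (W \o swap) (swap r) y
    <= 8 * dist t1 t2 + 2 * (`|t1.2 - r.2| + `|t2.2 - r.2|) ->
  exists t3' x', potential W q t1 t2 t3' x' y + et * th / 4 * m
                 <= potential W r t1 t2 t3 x y.
Proof.
move=> lip W0 dom sup es rt1 rt2 rt3 nt1 nt2 nt3 m1 m2 smallD bigL vb hb.
have D0 := near_ge0 nt1.
have vm := vterm_move lip W0 dom rt1 rt2 nt1 nt2 vb.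
have hm : vterm (W \o swap) (swap r) (swap t1) (swap t2) y
    <= vterm (W \o swap) (swap q) (swap t1) (swap t2) y + K * D.
  apply: vterm_move; rewrite ?dist_swap //.
  - exact: lipschitz_swap.
  - by move=> p; exact: W0.
  - exact: dominated_swap.
  - exact: request_set_swap.
  - exact: request_set_swap.
  - exact: near_swap.
  - exact: near_swap.
have B26 := B_gt; have et0 := et_gt0.
have K54 : 54 * D <= K * D by apply: ler_wpM2r => //; rewrite /K; lra.
have m0 : 0 < m by rewrite -(pmulr_rgt0 _ th_gt0); lra.
have thm : th * m <= 2^-1 * m by apply: ler_wpM2r; [exact: ltW|move: th_lt; lra].
have betam : m <= `|r.2 - q.2| by rewrite -es distrC.
have betaD : D < `|r.2 - q.2| by lra.
have [alpha_small|alpha_big] := leP (8 * (K * `|r.1 - q.1|)) (th * m).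
- have alpha54 : 54 * `|r.1 - q.1| <= K * `|r.1 - q.1|.
    by apply: ler_wpM2r => //; rewrite /K; lra.
  have Bsmall t : request_set r t -> near q D t ->
      16 * (B * `|t.1 - q.1|) <= th * m.
    move=> rt nt; have n0 := normr_ge0 (t.1 - q.1).
    suff : 8 * (K * `|t.1 - q.1|) <= th * m by rewrite /K; lra.
    case: rt => e; first by rewrite e.
    case: nt => h; last by move: h; rewrite e; lra.
    by have := ler_wpM2l (ltW K_gt0) h; lra.
  have b1 := Bsmall _ rt1 nt1; have b2 := Bsmall _ rt2 nt2.
  suff [x' hx'] : exists x', vterm W r t1 t2 x + 3 / 8 * (th * m)
      <= vterm W q t1 t2 x'.
    exists t3, x'; rewrite /potential.
    have := ler_wpM2l (ltW et0) hm; have := ler_wpM2l (ltW et0) hx'.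
    have : et * (8 * (K * D)) <= et * (th * m) by rewrite ler_pM2l // ltW.
    lra.
  have alpha0 := normr_ge0 (r.1 - q.1).
  (* [s.1] is the witness when the term in [x] is small or switched off. Otherwise [x] itself works,
     by its loss of slack in height. *)
  have at_s : 2 * `|r.1 - q.1| + 3 / 8 * (th * m) <= vterm W q t1 t2 s.1.
    have h1 := supported_vslack sup es.
    have h2 := vterm_ge W q t1 t2 s.1.
    have h3 : th * m <= th * (`|s.1 - q.1| + `|r.1 - q.1|).
      rewrite ler_pM2l //; apply: le_trans m1 _.
      by rewrite (distrC r.1 q.1); exact: ler_distD.
    have h4 : th * `|r.1 - q.1| <= 2^-1 * `|r.1 - q.1|.
      by apply: ler_wpM2r => //; move: th_lt; lra.
    lra.
  case: (vslack_move r x lip W0 dom) => mv.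
    exists s.1; apply: le_trans at_s; rewrite lerD2r ge_max.
    apply/andP; split; first by lra.
    have : 0 <= B * (`|t1.1 - r.1| + `|t2.1 - r.1|).
      by apply: mulr_ge0; [lra | exact: addr_ge0].
    lra.
  have [v0|v0] := leP (vslack W r x - B * (`|t1.1 - r.1| + `|t2.1 - r.1|)) 0.
    exists s.1; apply: le_trans at_s; rewrite lerD2r ge_max.
    by apply/andP; split; lra.
  exists x; rewrite {1}/vterm max_r; last exact: ltW.
  have h2 := vterm_ge W q t1 t2 x.
  have : 0 <= B * (`|t1.1 - r.1| + `|t2.1 - r.1|).
    by apply: mulr_ge0; [lra | exact: addr_ge0].
  have : th * m <= th * `|r.2 - q.2| by rewrite ler_pM2l.
  lra.
- have alphaD : D < `|r.1 - q.1|.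
    by rewrite -(ltr_pM2l K_gt0); lra.
  have c1 := crossing_near rt1 nt1 alphaD betaD.
  have c2 := crossing_near rt2 nt2 alphaD betaD.
  have c3 := crossing_near rt3 nt3 alphaD betaD.
  have sameV t t' : t.1 = r.1 /\ `|t.2 - q.2| <= D ->
      t'.1 = r.1 /\ `|t'.2 - q.2| <= D -> dist t t' <= 2 * D.
    move=> [e h] [e' h']; rewrite /dist e e' subrr normr0.
    by have := ler_distD q.2 t.2 t'.2; rewrite (distrC q.2); lra.
  have sameH t t' : t.2 = r.2 /\ `|t.1 - q.1| <= D ->
      t'.2 = r.2 /\ `|t'.1 - q.1| <= D -> dist t t' <= 2 * D.
    move=> [e h] [e' h']; rewrite /dist e e' subrr normr0.
    by have := ler_distD q.1 t.1 t'.1; rewrite (distrC q.1); lra.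
  have mn : Num.min (slack W t3 t1) (slack W t3 t2) <= 4 * D.
    have l1 := lipschitz_slack t3 t1 lip; have l2 := lipschitz_slack t3 t2 lip.
    rewrite ge_min; apply/orP.
    (* Three points share two intersections. If [t1] and [t2] share one, their distance is at most
       [2 * D], against [bigL]. *)
    case: c1 => c1; case: c2 => c2.
    + by have := sameV _ _ c1 c2; lra.
    + case: c3 => c3; [left | right].
      * by have := sameV _ _ c3 c1; lra.
      * by have := sameH _ _ c3 c2; lra.
    + case: c3 => c3; [right | left].
      * by have := sameV _ _ c3 c2; lra.
      * by have := sameH _ _ c3 c1; lra.
    + by have := sameH _ _ c1 c2; lra.
  have ms : th * m <= Num.min (slack W s t1) (slack W s t2).
    have far t : request_set r t -> th * m <= slack W s t.
      move=> rt; apply: le_trans (supported_slack t sup).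
      rewrite ler_pM2l // /dist; case: rt => ->.
      + by have := normr_ge0 (s.2 - t.2); lra.
      + by have := normr_ge0 (s.1 - t.1); lra.
    by rewrite le_min !far.
  exists s, x; rewrite /potential.
  have h1 := ler_wpM2l (ltW et0) vm; have h2 := ler_wpM2l (ltW et0) hm.
  have h3 := ler_wpM2l de_ge0 mn; have h4 := ler_wpM2l de_ge0 ms.
  have h5 : et * (K * D) = th * th / 16 * D by rewrite mulrA et_K.
  have h6 : th * (432 * D) <= th * (th * m) by rewrite ler_pM2l //; lra.
  have h7 : th * (th * D) <= th * (2^-1 * D).
    by rewrite ler_pM2l //; apply: ler_wpM2r => //; move: th_lt; lra.
  have h8 : et * (th * m) <= th / 16 * (th * m).
    by apply: ler_wpM2r; [apply: mulr_ge0; apply: ltW | apply: ltW et_lt].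
  have h9 := mulr_ge0 (ltW th_gt0) (mulr_ge0 (ltW th_gt0) (ltW m0)).
  by rewrite /de in h3 h4 *; lra.
Qed.

(** * Growth of the potential at a request *)

Lemma near_le q D D' t : D <= D' -> near q D t -> near q D' t.
Proof. by move=> le [h|h]; [left | right]; exact: le_trans le. Qed.

Lemma dist_request_set r s t m : request_set r t ->
  m <= `|s.1 - r.1| -> m <= `|s.2 - r.2| -> m <= dist s t.
Proof.
rewrite /dist => -[] -> h1 h2.
- by have := normr_ge0 (s.2 - t.2); lra.
- by have := normr_ge0 (s.1 - t.1); lra.
Qed.

Lemma exists_max_slack W t p1 p2 : exists p,
  slack W p1 t <= slack W p t /\ slack W p2 t <= slack W p t.
Proof.
by have [h|/ltW h] := leP (slack W p1 t) (slack W p2 t); [exists p2 | exists p1].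
Qed.

Definition gain : R := et * th / 4.

Lemma gain_gt0 : 0 < gain.
Proof. by rewrite divr_gt0 // mulr_gt0 // et_gt0. Qed.

(** Three ways to improve: use a point of large slack over [t1], project points far from the old
    cross, or apply [near_potential_improves], after an exchange of coordinates if [s] is on the
    vertical line of [q]. Since [s] competes for the largest slack, failure of the first way gives
    [th * m < 8 * dist t1 t2]. *)
Lemma potential_improves W q r s t1 t2 t3 x y m :
  lipschitz W -> (forall p, 0 <= W p) -> dominated W q -> supported W s ->
  request_set r t1 -> request_set r t2 -> request_set r t3 ->
  0 <= m -> m <= `|s.1 - r.1| -> m <= `|s.2 - r.2| ->
  exists t1' t2' t3' x' y',
    potential W q t1' t2' t3' x' y' + gain * m <= potential W r t1 t2 t3 x y.
Proof.
move=> lip W0 dom sup rt1 rt2 rt3 m0 m1 m2; rewrite /gain.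
have et0 := et_gt0; have thm := mulr_ge0 (ltW th_gt0) m0.
have zs : th * m <= slack W s t1.
  apply: le_trans (supported_slack t1 sup); rewrite ler_pM2l //.
  exact: dist_request_set rt1 m1 m2.
have [p1 [z1 z2]] := exists_max_slack W t1 s t3.
have [p2 [z3 z4]] := exists_max_slack W t1 (x, r.2) (r.1, y).
have [p [z5 z6]] := exists_max_slack W t1 p1 p2.
have [big|small] := leP (8 * dist t1 t2) (slack W p t1).
  exists t1, p, p, x, y.
  have h : et * (th * m) <= 1 * (th * m).
    by apply: ler_wpM2r => //; have := et_lt; move: th_lt; lra.
  have := @potential_pair_improves W q r t1 t2 t3 p x y lip W0; lra.
have vb : vslack W r x <= 8 * dist t1 t2
    + 2 * (`|t1.1 - r.1| + `|t2.1 - r.1|).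
  have := vslack_le_slack r t1 x lip W0.
  by have := normr_ge0 (t2.1 - r.1); lra.
have lip' := lipschitz_swap lip.
have W0' t : 0 <= (W \o swap) t by exact: W0.
have hb : vslack (W \o swap) (swap r) y <= 8 * dist t1 t2
    + 2 * (`|t1.2 - r.2| + `|t2.2 - r.2|).
  have := vslack_le_slack (swap r) (swap t1) y lip' W0'.
  rewrite (slack_swap W (r.1, y) t1) /=.
  by have := normr_ge0 (t2.2 - r.2); lra.
have [t1' [rt1' w1 n1 a1 b1]] := dominated_projection t1 dom.
have [t2' [rt2' w2 n2 a2 b2]] := dominated_projection t2 dom.
have [t3' [rt3' w3 n3 a3 b3]] := dominated_projection t3 dom.
set D := dist t1 t1' + dist t2 t2' + dist t3 t3'.
have d1 := dist_ge0 t1 t1'; have d2 := dist_ge0 t2 t2'.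
have d3 := dist_ge0 t3 t3'.
have nD1 : near q D t1 by apply: near_le n1; rewrite /D; lra.
have nD2 : near q D t2 by apply: near_le n2; rewrite /D; lra.
have nD3 : near q D t3 by apply: near_le n3; rewrite /D; lra.
have [Dbig|Dsmall] := leP (th * m) (8 * (K * D)).
  exists t1', t2', t3', x, y.
  have pp := @potential_projection W q t1 t2 t3 t1' t2' t3' x y
    w1 w2 w3 a1 a2 b1 b2.
  (* Projection gains [th * th / 4 * D] and the two line terms take back at most half; the other
     half covers [gain * m]. *)
  apply: (@le_trans _ _ (potential W q t1 t2 t3 x y - th * th / 8 * D)).
    have := ler_wpM2l (ltW et0) Dbig.
    have : et * (K * D) = th * th / 16 * D by rewrite mulrA et_K.
    by move: pp; rewrite -/D /de; lra.
  have vm := vterm_move lip W0 dom rt1 rt2 nD1 nD2 vb.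
  have hm := @vterm_move (W \o swap) (swap q) (swap r) (swap t1) (swap t2) y D
    lip' W0' (dominated_swap dom) (request_set_swap rt1) (request_set_swap rt2)
    (near_swap nD1) (near_swap nD2).
  rewrite dist_swap in hm; have {}hm := hm hb.
  have := ler_wpM2l (ltW et0) vm; have := ler_wpM2l (ltW et0) hm.
  have : et * (K * D) = th * th / 16 * D by rewrite mulrA et_K.
  by rewrite /potential; lra.
case: (supported_request_set dom sup) => es.
- have bigL : th * m < 8 * dist (swap t1) (swap t2).
    by rewrite dist_swap; lra.
  have hb' : vslack (W \o swap) (swap r) y <= 8 * dist (swap t1) (swap t2)
      + 2 * (`|(swap t1).1 - (swap r).1| + `|(swap t2).1 - (swap r).1|).
    by rewrite dist_swap.
  have vb' : vslack ((W \o swap) \o swap) (swap (swap r)) x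
      <= 8 * dist (swap t1) (swap t2)
      + 2 * (`|(swap t1).2 - (swap r).2| + `|(swap t2).2 - (swap r).2|).
    by rewrite dist_swap.
  have [u3 [y' h]] := @near_potential_improves (W \o swap) (swap q) (swap r)
    (swap s) (swap t1) (swap t2) (swap t3) y x m D lip' W0'
    (dominated_swap dom) (supported_swap sup) es (request_set_swap rt1)
    (request_set_swap rt2) (request_set_swap rt3) (near_swap nD1)
    (near_swap nD2) (near_swap nD3) m2 m1 Dsmall bigL hb' vb'.
  exists t1, t2, (swap u3), x, y'.
  by move: h; rewrite -{1}(swapK u3) !potential_swap.
- have [u3 [x' h]] := @near_potential_improves W q r s t1 t2 t3 x y m D lip W0
    dom sup es rt1 rt2 rt3 nD1 nD2 nD3 m1 m2 Dsmall ltac:(lra) vb hb.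
  by exists t1, t2, u3, x', y.
Qed.

(** At points of the cross of [r], every value entering the potential is taken on that cross, where
    a new request leaves the work function unchanged. *)
Lemma eq_potential W U r t1 t2 t3 x y : (forall p, request_set r p -> U p = W p) ->
  request_set r t1 -> request_set r t2 -> request_set r t3 ->
  potential U r t1 t2 t3 x y = potential W r t1 t2 t3 x y.
Proof.
move=> eqUW rt1 rt2 rt3; rewrite /potential /slack !eqUW //.
have ev y' : U (r.1, y') = W (r.1, y') by apply: eqUW; left.
have eh x' : U (x', r.2) = W (x', r.2) by apply: eqUW; right.
have fv : (fun y' => U (r.1, y')) = (fun y' => W (r.1, y')) by apply/funext.
have fh : (fun x' => U (x', r.2)) = (fun x' => W (x', r.2)) by apply/funext.
by rewrite /vterm /vslack /= /swap /= fv fh ev eh.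
Qed.

Lemma potential_step W U q r s t1 t2 t3 x y m :
  lipschitz W -> (forall p, 0 <= W p) -> dominated W q -> supported W s ->
  (forall p, request_set r p -> U p = W p) -> dominated U r ->
  0 <= m -> m <= `|s.1 - r.1| -> m <= `|s.2 - r.2| ->
  exists t1' t2' t3' x' y',
    potential W q t1' t2' t3' x' y' + gain * m <= potential U r t1 t2 t3 x y.
Proof.
move=> lip W0 dom sup eqUW domU m0 m1 m2.
have [t1' [rt1 w1 _ a1 b1]] := dominated_projection t1 domU.
have [t2' [rt2 w2 _ a2 b2]] := dominated_projection t2 domU.
have [t3' [rt3 w3 _ a3 b3]] := dominated_projection t3 domU.
have [u1 [u2 [u3 [x' [y' h]]]]] := @potential_improves W q r s t1' t2' t3' x y m
  lip W0 dom sup rt1 rt2 rt3 m0 m1 m2.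
exists u1, u2, u3, x', y'; apply: le_trans h _.
rewrite -(eq_potential x y eqUW rt1 rt2 rt3).
apply: le_trans (potential_projection x y w1 w2 w3 a1 a2 b1 b2).
rewrite lerDl; apply: mulr_ge0; last by rewrite !addr_ge0 ?dist_ge0.
by apply: mulr_ge0; [exact: de_ge0 | exact: ltW].
Qed.

(** A path through [O] shows that every slack over [t1] is at most [2 * W t1]. *)
Lemma potential_ge0 W O q t1 t2 t3 x y : lipschitz W ->
  (forall p, dist O p <= W p) -> 0 <= potential W q t1 t2 t3 x y.
Proof.
move=> lip WO; have W0 p : 0 <= W p by apply: le_trans (WO p); exact: dist_ge0.
have sl p : slack W p t1 <= 2 * W t1.
  have := dist_triangle p O t1; have := WO p; have := WO t1.
  have := mulr_ge0 (ltW th_gt0) (dist_ge0 p t1).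
  by rewrite /slack (distC p O); lra.
apply: le_trans (potential_ge t2 lip W0 _ (sl t3) (sl _) (sl _)); last first.
  by rewrite mulr_ge0.
have h1 : (1 - th) * dist t1 t2 <= (1 - th) * (W t1 + W t2).
  apply: ler_wpM2l; first by move: th_lt; lra.
  have := dist_triangle t1 O t2; rewrite (distC t1 O).
  by have := WO t1; have := WO t2; lra.
have h2 : (de + 2 * et) * (2 * W t1) <= (th / 2) * (2 * W t1).
  apply: ler_wpM2r; first exact: mulr_ge0.
  by have := et_lt; rewrite /de; move: th_gt0; lra.
have := mulr_ge0 (ltW th_gt0) (W0 t2).
lra.
Qed.

Lemma potential_diag W q t x y : potential W q t t t x y <= 2 * W t.
Proof.
have e : slack W t t = 0 by rewrite /slack distxx mulr0 addr0 subrr.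
by have := @potential_pair W q t t x y; rewrite e subr0; apply.
Qed.

End Potential.

(** * Work functions *)

Section WorkFunction.
Variable R : realType.
Implicit Types (O p r s t : R * R) (sigma ss : seq (R * R)).

Lemma serves_rcons sigma r ss : serves (rcons sigma r) ss ->
  exists ss' s, [/\ ss = rcons ss' s, serves sigma ss' & request_set r s].
Proof.
elim: sigma ss => [|r' sigma IH] [|s ss] //=.
  by case: ss => [|? ?] [] //; exists [::], s.
by move=> [rs /IH[ss' [s' [-> h rs']]]]; exists (s :: ss'), s'.
Qed.

Lemma serves_rconsE sigma r ss s : serves sigma ss -> request_set r s ->
  serves (rcons sigma r) (rcons ss s).
Proof.
elim: sigma ss => [|r' sigma IH] [|s' ss] //= [h1 h2] h3.
by split=> //; exact: IH.
Qed.

Lemma work_nil O s : work O [::] s = dist O s.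
Proof.
by have [[[|//] _ <-] _] := work_minimum O [::] s; rewrite /= addr0.
Qed.

Lemma work_lipschitz O sigma : lipschitz (work O sigma).
Proof.
move=> p t; have [[ss hss <-] _] := work_minimum O sigma t.
have [_ /(_ ss hss)] := work_minimum O sigma p.
rewrite !travel_rcons; have := dist_triangle (last O ss) t p.
by rewrite (distC p t); lra.
Qed.

Lemma le_work_rcons O sigma r p : work O sigma p <= work O (rcons sigma r) p.
Proof.
have [[ss hss <-] _] := work_minimum O (rcons sigma r) p.
have [ss' [s [-> hs' rs]]] := serves_rcons hss.
have [_ /(_ ss' hs')] := work_minimum O sigma p.
rewrite !travel_rcons last_rcons; have := dist_triangle (last O ss') s p; lra.
Qed.

Lemma work_rcons_request O sigma r p : request_set r p ->
  work O (rcons sigma r) p = work O sigma p.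
Proof.
move=> rp; apply/eqP; rewrite eq_le le_work_rcons andbT.
have [[ss hss <-] _] := work_minimum O sigma p.
have [_ /(_ (rcons ss p) (serves_rconsE hss rp))] :=
  work_minimum O (rcons sigma r) p.
by rewrite !travel_rcons last_rcons distxx addr0.
Qed.

(** An optimal path to [p] leaves the cross at its last service point [s], and the projection of [p]
    onto the line containing [s] lies on a shortest path from [s] to [p]. *)
Lemma work_rcons_dominated O sigma r : dominated (work O (rcons sigma r)) r.
Proof.
move=> p; have [[ss hss e] _] := work_minimum O (rcons sigma r) p.
have [ss' [s [ess hs' rs]]] := serves_rcons hss.
have h : work O (rcons sigma r) s + dist s p <= work O (rcons sigma r) p.
  rewrite -e ess travel_rcons last_rcons lerD2r work_rcons_request //.
  by have [_ /(_ ss' hs')] := work_minimum O sigma s.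
have lip := @work_lipschitz O (rcons sigma r).
case: rs => es; [left | right].
- have := lip (r.1, p.2) s; move: h.
  by rewrite /dist /= es subrr normr0 (distrC p.1) (distrC p.2); lra.
- have := lip (p.1, r.2) s; move: h.
  by rewrite /dist /= es subrr normr0 (distrC p.1) (distrC p.2); lra.
Qed.

Lemma dist_le_work O sigma p : dist O p <= work O sigma p.
Proof.
elim/last_ind: sigma => [|sigma r IH]; first by rewrite work_nil.
exact: le_trans IH (le_work_rcons _ _ _ _).
Qed.

Lemma work_nil_dominated O : dominated (work O [::]) O.
Proof.
by move=> p; left; rewrite !work_nil /dist /= subrr normr0 (distrC p.1); lra.
Qed.

Lemma argmin_supported (f : R * R -> R) (th : R) s t : th < 2^-1 ->
  argmin (fun u => f u + (1 - 2 * th) * dist s u) t -> supported th f t.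
Proof.
move=> th_lt h u; have := h u.
have : (1 - 2 * th) * dist s u <= (1 - 2 * th) * (dist s t + dist t u).
  by apply: ler_wpM2l; [lra | exact: dist_triangle].
lra.
Qed.

End WorkFunction.

(** * The competitive ratio *)

Theorem theorem1 (R : realType) (lambda : R) (hlambda : 0 < lambda < 1) :
  exists2 c : R, 1 <= c & competitive c (WFA lambda).
Proof.
case/andP: hlambda => l0 l1.
pose th := (1 - lambda) / 2.
have th0 : 0 < th by rewrite /th; lra.
have th2 : th < 2^-1 by rewrite /th; lra.
have el : lambda = 1 - 2 * th by rewrite /th; field.
have g0 := gain_gt0 th0 th2; set g := gain th in g0.
(* The argument yields the ratio [4 / (g * lambda)]; the added 1 ensures [1 <= c]. *)
exists (1 + 4 / (g * lambda)).
  by rewrite lerDl; apply: divr_ge0 => //; apply: mulr_ge0; exact: ltW.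
exists 0 => O rho ss [sz run]; rewrite addr0.
(* The origin acts as request number 0, so the request served in step [i] is [q i.+1]. *)
pose W i := work O (take i rho); pose q i := nth O (O :: rho) i.
pose s i := nth O (O :: ss) i.
have W0 i p : 0 <= W i p by apply: le_trans (dist_le_work _ _ _); exact: dist_ge0.
have lip i : lipschitz (W i) by exact: work_lipschitz.
have takeS i : (i < size rho)%N -> take i.+1 rho = rcons (take i rho) (q i.+1).
  by move=> lti; rewrite (take_nth O).
have dom i : (i <= size rho)%N -> dominated (W i) (q i).
  case: i => [_|i lti]; first by rewrite /W take0; exact: work_nil_dominated.
  by rewrite /W takeS //; exact: work_rcons_dominated.
have sup i : (i <= size rho)%N -> supported th (W i) (s i).
  case: i => [_|i lti].
    move=> t; rewrite /W take0 !work_nil distxx -el.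
    by apply: addr_ge0; rewrite ?mulr_ge0 ?dist_ge0 //; exact: ltW.
  by have := run i lti; rewrite {1}el; exact: argmin_supported.
(* All points at time [i] against some points at time 0: this compares infima of the potential
   without forming them. A request adds [g * m] to the potential and at most [2 * m] to the bracket,
   hence the factor [g / 2]. *)
have chain i : (i <= size rho)%N -> forall t1 t2 t3 x y,
  exists t1' t2' t3' x' y', potential th (W 0%N) (q 0%N) t1' t2' t3' x' y'
    + g / 2 * (lambda * travel O (take i ss) + W i (s i))
  <= potential th (W i) (q i) t1 t2 t3 x y.
  elim: i => [_|i IH lti] t1 t2 t3 x y.
    exists t1, t2, t3, x, y.
    by rewrite take0 /= mulr0 add0r /W take0 work_nil distxx mulr0 addr0.
  pose r := q i.+1.
  pose m := Num.min `|(s i).1 - r.1| `|(s i).2 - r.2|.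
  have eqW p : request_set r p -> W i.+1 p = W i p.
    by move=> rp; rewrite /W takeS // work_rcons_request.
  have m0 : 0 <= m by rewrite le_min !normr_ge0.
  have m1 : m <= `|(s i).1 - r.1| by rewrite ge_min lexx.
  have m2 : m <= `|(s i).2 - r.2| by rewrite ge_min lexx orbT.
  have [u1 [u2 [u3 [x1 [y1 hu]]]]] := @potential_step _ th th0 th2
    (W i) (W i.+1) (q i) r (s i) t1 t2 t3 x y m (lip i) (W0 i)
    (dom _ (ltnW lti)) (sup _ (ltnW lti)) eqW (dom _ lti) m0 m1 m2.
  have [v1 [v2 [v3 [x2 [y2 hv]]]]] := IH (ltnW lti) u1 u2 u3 x1 y1.
  exists v1, v2, v3, x2, y2; apply: le_trans hu.
  (* A detour to the nearer line of the new cross and back. *)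
  have extended : W i.+1 (s i) <= W i (s i) + 2 * m.
    rewrite /m; have [_|_] := leP `|(s i).1 - r.1| `|(s i).2 - r.2|.
    - have := lip i.+1 (s i) (r.1, (s i).2).
      have := lip i (r.1, (s i).2) (s i).
      rewrite (eqW (r.1, (s i).2)); last by left.
      by rewrite /dist /= subrr normr0 (distrC r.1); lra.
    - have := lip i.+1 (s i) ((s i).1, r.2).
      have := lip i ((s i).1, r.2) (s i).
      rewrite (eqW ((s i).1, r.2)); last by right.
      by rewrite /dist /= subrr normr0 (distrC r.2); lra.
  have move_le : W i.+1 (s i.+1) + lambda * dist (s i) (s i.+1) <= W i.+1 (s i).
    by have := run i lti (s i); rewrite distxx mulr0 addr0.
  have -> : travel O (take i.+1 ss)
      = travel O (take i ss) + dist (s i) (s i.+1).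
    rewrite (take_nth O) ?sz // travel_rcons; congr (_ + dist _ _).
    rewrite /s -nth_last size_take sz lti.
    by case: (i) => [|j] /=; rewrite ?take0 ?nth_take.
  have gap := ler_wpM2l (ltW g0) (le_trans move_le extended).
  by rewrite -/g in hv *; lra.
have [[os hos eos] _] := opt_minimum O rho.
have [t1 [t2 [t3 [x [y h]]]]] :=
  chain _ (leqnn _) (last O os) (last O os) (last O os) 0 0.
have p0 := @potential_ge0 _ th th0 th2 (W 0%N) O (q 0%N) t1 t2 t3 x y (lip _)
  (dist_le_work _ _).
have pn := potential_diag th0 th2 (W (size rho)) (q (size rho)) (last O os) 0 0.
have wn : W (size rho) (last O os) <= opt O rho.
  rewrite /W take_size -eos.
  have [_ /(_ os hos)] := work_minimum O rho (last O os).
  by rewrite travel_rcons distxx addr0.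
have opt0 : 0 <= opt O rho by rewrite -eos travel_ge0.
rewrite -{1}sz take_size in h.
have Wn0 := mulr_ge0 (ltW g0) (W0 (size rho) (s (size rho))).
have key : (g * lambda) * travel O ss <= 4 * opt O rho by lra.
rewrite mulrDl mul1r -[leLHS]add0r; apply: lerD => //.
by rewrite mulrAC ler_pdivlMr; [rewrite mulrC | exact: mulr_gt0].
Qed.
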